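(* Let $\mathcal H$ be a real Hilbert space. Let $\Psi: \mathcal H \to \mathbb R \cup \{+\infty\}$ be proper, lower-semicontinuous and convex, and let $\Phi: \mathcal H \to \mathbb R$ be convex and continuously differentiable with $L$-Lipschitz continuous gradient. Suppose that $S=\operatorname{argmin}(\Psi+\Phi)\neq\emptyset$. Let $\alpha>3$ and $0<s<\frac1L$, let $(g_k)$ be a sequence in $\mathcal H$, and let $(x_k)$ be generated by the inexact scheme: given arbitrary $x_0,x_1\in\mathcal H$, for $k\ge1$, $$y_k = x_k + \frac{k-1}{k+\alpha-1}(x_k-x_{k-1}),\qquad x_{k+1} = \operatorname{prox}_{s\Psi}\big(y_k - s(\nabla\Phi(y_k) - g_k)\big).$$ If $\sum_{k=1}^\infty k\|g_k\|<+\infty$, then $$\lim_{k\to\infty}k^2\Big((\Psi+\Phi)(x_k)-\min(\Psi+\Phi)\Big)=0,\qquad \lim_{k\to\infty}k\|x_{k+1}-x_k\|=0,$$ and $(x_k)$ converges weakly to a point in $S$.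
   Context: $\operatorname{prox}_{s\Psi}(z) = \operatorname{argmin}_{u\in\mathcal H}\{\Psi(u) + \frac{1}{2s}\|u-z\|^2\}$ denotes the proximal operator. *)

(* Defs.v *)
From HB Require Import structures.
From mathcomp Require Import all_boot all_order all_algebra.
From mathcomp Require Import all_classical all_reals all_analysis.
Set Implicit Arguments. Unset Strict Implicit. Unset Printing Implicit Defensive.
Import Order.TTheory GRing.Theory Num.Theory.
Import numFieldNormedType.Exports.
Local Open Scope classical_set_scope.
Local Open Scope ring_scope.

Definition is_inner_product (R : realType) (H : completeNormedModType R)
  (ip : H -> H -> R) : Prop :=
  [/\ (forall x y, ip x y = ip y x),
      (forall a x y z, ip (a *: x + y) z = a * ip x z + ip y z) &
      (forall x, ip x x = `|x| ^+ 2)].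

Definition weak_cvg (R : realType) (H : completeNormedModType R)
  (ip : H -> H -> R) (u : nat -> H) (l : H) : Prop :=
  forall y, (fun k => ip (u k) y) @ \oo --> ip l y.

Definition proper_fun (R : realType) (T : Type) (f : T -> \bar R) : Prop :=
  (forall x, f x != -oo%E) /\ (exists x, f x != +oo%E).

Definition convex_ext (R : realType) (H : lmodType R) (f : H -> \bar R) : Prop :=
  forall (x y : H) (t : R), 0 < t < 1 ->
    let v := t *: x + (1 - t) *: y in
    (f v <= t%:E * f x + (1 - t)%:E * f y)%E.

Definition convex_real (R : realType) (H : lmodType R) (f : H -> R) : Prop :=
  forall (x y : H) (t : R), 0 <= t <= 1 ->
    f (t *: x + (1 - t) *: y) <= t * f x + (1 - t) * f y.

Definition is_prox (R : realType) (H : normedModType R) (s : R)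
  (Psi : H -> \bar R) (z p : H) : Prop :=
  forall u : H, let dp := (2 * s)^-1 * `|p - z| ^+ 2 in
                let du := (2 * s)^-1 * `|u - z| ^+ 2 in
                (Psi p + dp%:E <= Psi u + du%:E)%E.

(* Main.v *)
Require Import Defs.
From HB Require Import structures.
From mathcomp Require Import all_boot all_order all_algebra.
From mathcomp Require Import all_classical all_reals all_analysis.
From mathcomp Require Import ring lra.
Import Order.TTheory GRing.Theory Num.Theory.
Import numFieldNormedType.Exports.
Local Open Scope classical_set_scope.
Local Open Scope ring_scope.

(** With lam = alpha - 1, m = min (Psi + Phi), theta_k = (Psi + Phi)(x_k) - m and
    w_k = (k-1+lam) x_k - (k-1) x_{k-1}, combining the forward-backward
    inequality at x_k (weight k) and at z in S (weight lam) makes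
    (k-1+lam)^2 theta_k + |w_k - lam z|^2 / 2s decrease up to the error
    (k+lam) |g_k| |w_{k+1} - lam z|. A discrete Gronwall argument bounds w_k, so
    this energy converges, and since lam > 2 the sum of k theta_k is finite.
    The inequality at x_k alone then controls
    G_k = (k-1+lam)^2 (theta_k + |x_k - x_{k-1}|^2 / 2s): it converges and the
    sum of G_k / k is finite, hence G_k tends to 0, which gives both rates.
    As w_k - lam z = lam (x_k - z) + (k-1)(x_k - x_{k-1}), the distances
    |x_k - z| converge, and Opial's argument concludes.

    Weak compactness is replaced by an elementary fact: a bounded sequence has
    a point lying in every closed convex set that contains a tail of it (almost
    minimal norm points of the closed convex hulls of the tails form a Cauchy
    sequence). Applied to sublevel sets and half-spaces, this is all that
    Opial's argument needs. *)

(** * Real sequences with summable errors *)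

(** By strong induction: an [a n.+1] above the bound dominates all earlier terms, so the sum is at
    most [B * a n.+1]; but a^2 <= C + B a is impossible when a > 1 + C + B. *)
Lemma discrete_gronwall {R : realType} (a b : nat -> R) (C B : R) :
    (forall n, 0 <= a n) -> (forall n, 0 <= b n) -> 0 <= C -> a 0%N ^+ 2 <= C ->
    (forall n, \sum_(0 <= j < n) b j <= B) ->
    (forall n, a n.+1 ^+ 2 <= C + \sum_(0 <= j < n.+1) b j * a j.+1) ->
  forall n, a n <= 1 + C + B.
Proof.
move=> a0 b0 C0 aC bB rec n; elim/ltn_ind: n => -[_|n IH].
  have B0 : 0 <= B by have := bB 0%N; rewrite big_nil.
  have := a0 0%N; nra.
rewrite leNgt; apply/negP => aM.
have B0 : 0 <= B by have := bB 0%N; rewrite big_nil.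
have le_sum : \sum_(0 <= j < n.+1) b j * a j.+1 <= B * a n.+1.
  apply: (@le_trans _ _ (\sum_(0 <= j < n.+1) b j * a n.+1)); last first.
    by rewrite -mulr_suml ler_wpM2r.
  rewrite !big_nat; apply: ler_sum => j; rewrite ltnS => /andP[_ jn].
  apply: ler_wpM2l => //; move: jn; rewrite leq_eqVlt => /predU1P[-> //|jn].
  by apply: (le_trans (IH j.+1 _)); rewrite ?ltnS // ltW.
have := rec n; nra.
Qed.

(** Subtracting the convergent partial sums of [b] makes [e] nonincreasing and bounded below;
    telescoping bounds the sum of [r]. *)
Lemma quasi_descent {R : realType} (e r b : nat -> R) (B : R) :
    (forall n, 0 <= e n) -> (forall n, 0 <= r n) -> (forall n, 0 <= b n) ->
    (forall n, \sum_(0 <= j < n) b j <= B) ->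
    (forall n, e n.+1 + r n <= e n + b n) ->
  cvgn e /\ forall n, \sum_(0 <= j < n) r j <= e 0%N + B.
Proof.
move=> e0 r0 b0 bB ed; split; last first.
  move=> n; suff : e n + \sum_(0 <= j < n) r j <= e 0%N + \sum_(0 <= j < n) b j.
    by have := e0 n; have := bB n; lra.
  elim: n => [|n IH]; first by rewrite !big_nil.
  by rewrite !big_nat_recr //=; have := ed n; lra.
have cb : cvgn (series b).
  apply: nondecreasing_is_cvgn.
    by apply/nondecreasing_seqP => n; rewrite seriesS /= lerDr.
  by exists B => _ [n _ <-]; apply: bB.
have ce : cvgn (e - series b).
  apply: nonincreasing_is_cvgn.
    apply/nonincreasing_seqP => n; rewrite !fctE seriesS /=.
    by have := ed n; have := r0 n; lra.
  by exists (- B) => _ [n _ <-]; rewrite !fctE; have := bB n; have := e0 n;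
    rewrite /series /=; lra.
have -> : e = (e - series b) + series b by rewrite subrK.
exact: is_cvgD.
Qed.

(** A positive limit l would give 1/(n+1) <= (2/l) e_n/(n+1) eventually, and the harmonic series
    would converge. *)
Lemma cvg0_of_sum_harmonic {R : realType} (e : nat -> R) (B : R) :
    (forall n, 0 <= e n) -> cvgn e ->
    (forall n, \sum_(0 <= j < n) e j / j.+1%:R <= B) ->
  e @ \oo --> (0 : R).
Proof.
move=> e0 ce eB; suff -> : 0 = limn e by [].
apply/eqP; rewrite eq_le limr_ge //=; last by near=> n.
rewrite leNgt; apply/negP => l0.
have [N _ eN] : \forall n \near \oo, limn e / 2 < e n.
  by apply: (cvgr_gt (limn e)) => //; lra.
apply: (@dvg_harmonic R); rewrite -(is_cvg_series_restrict N).
apply: nondecreasing_is_cvgn.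
  apply/nondecreasing_seqP => n /=; case: (leqP N n) => Nn.
    by rewrite big_nat_recr //= lerDl invr_ge0.
  by rewrite !big_geq // ltnW.
exists (2 * B / limn e) => _ [n _ <-].
rewrite ler_pdivlMr // -ler_pdivrMl // mulrC -mulrA mulr_suml.
apply: le_trans (eB n); case: (leqP N n) => Nn; last first.
  by rewrite big_geq ?sumr_ge0 // 1?ltnW // => i _; rewrite divr_ge0.
rewrite [leRHS](@big_cat_nat _ _ _ N) //=; apply: ler_wpDl.
  by rewrite sumr_ge0 // => i _; rewrite divr_ge0.
rewrite !big_nat ler_sum // => i /andP[Ni _].
by rewrite mulrC ler_wpM2r ?invr_ge0 // ltW // eN.
Unshelve. all: by end_near. Qed.

(** * Midpoint convexity and inner product calculus *)

(** Midpoint convexity suffices for closed sets and is quicker to check. *)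
Definition midconvex {R : realType} {V : lmodType R} (C : set V) : Prop :=
  forall a b, C a -> C b -> C (2^-1 *: (a + b)).

Lemma ipC {R : realType} {H : completeNormedModType R} {ip : H -> H -> R}
  (Hip : is_inner_product ip) x y : ip x y = ip y x.
Proof. by case: Hip. Qed.

Lemma ipxx {R : realType} {H : completeNormedModType R} {ip : H -> H -> R}
  (Hip : is_inner_product ip) x : ip x x = `|x| ^+ 2.
Proof. by case: Hip. Qed.

Lemma ipDl {R : realType} {H : completeNormedModType R} {ip : H -> H -> R}
  (Hip : is_inner_product ip) x y z : ip (x + y) z = ip x z + ip y z.
Proof. by case: Hip => _ lin _; rewrite -[x in LHS]scale1r lin mul1r. Qed.

Lemma ip0l {R : realType} {H : completeNormedModType R} {ip : H -> H -> R}
  (Hip : is_inner_product ip) z : ip 0 z = 0.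
Proof. by have := ipDl Hip 0 0 z; rewrite addr0; lra. Qed.

Lemma ipZl {R : realType} {H : completeNormedModType R} {ip : H -> H -> R}
  (Hip : is_inner_product ip) a x z : ip (a *: x) z = a * ip x z.
Proof.
by case: (Hip) => _ lin _; rewrite -[a *: x]addr0 lin (ip0l Hip) addr0.
Qed.

Lemma ipNl {R : realType} {H : completeNormedModType R} {ip : H -> H -> R}
  (Hip : is_inner_product ip) x z : ip (- x) z = - ip x z.
Proof. by rewrite -scaleN1r (ipZl Hip) mulN1r. Qed.

Lemma ipBl {R : realType} {H : completeNormedModType R} {ip : H -> H -> R}
  (Hip : is_inner_product ip) x y z : ip (x - y) z = ip x z - ip y z.
Proof. by rewrite (ipDl Hip) (ipNl Hip). Qed.

Lemma ipDr {R : realType} {H : completeNormedModType R} {ip : H -> H -> R}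
  (Hip : is_inner_product ip) x y z : ip z (x + y) = ip z x + ip z y.
Proof. by rewrite !(ipC Hip z) (ipDl Hip). Qed.

Lemma ipZr {R : realType} {H : completeNormedModType R} {ip : H -> H -> R}
  (Hip : is_inner_product ip) a x z : ip z (a *: x) = a * ip z x.
Proof. by rewrite !(ipC Hip z) (ipZl Hip). Qed.

Lemma ipNr {R : realType} {H : completeNormedModType R} {ip : H -> H -> R}
  (Hip : is_inner_product ip) x z : ip z (- x) = - ip z x.
Proof. by rewrite !(ipC Hip z) (ipNl Hip). Qed.

Lemma ipBr {R : realType} {H : completeNormedModType R} {ip : H -> H -> R}
  (Hip : is_inner_product ip) x y z : ip z (x - y) = ip z x - ip z y.
Proof. by rewrite (ipDr Hip) (ipNr Hip). Qed.

Lemma sqrnormD {R : realType} {H : completeNormedModType R} {ip : H -> H -> R}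
  (Hip : is_inner_product ip) x y :
  `|x + y| ^+ 2 = `|x| ^+ 2 + 2 * ip x y + `|y| ^+ 2.
Proof.
rewrite -!(ipxx Hip) (ipDl Hip) !(ipDr Hip) (ipC Hip y x); ring.
Qed.

Lemma sqrnormB {R : realType} {H : completeNormedModType R} {ip : H -> H -> R}
  (Hip : is_inner_product ip) x y :
  `|x - y| ^+ 2 = `|x| ^+ 2 - 2 * ip x y + `|y| ^+ 2.
Proof. by rewrite (sqrnormD Hip) (ipNr Hip) normrN mulrN. Qed.

(** Cauchy-Schwarz, read off from the square of the norm of |y| x - |x| y, which equals 2 |x| |y|
    (|x| |y| - <x, y>). *)
Lemma ip_le_norm {R : realType} {H : completeNormedModType R}
  {ip : H -> H -> R} (Hip : is_inner_product ip) x y :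
  ip x y <= `|x| * `|y|.
Proof.
have [->|y0] := eqVneq y 0; first by rewrite (ipC Hip) (ip0l Hip) normr0 mulr0.
have ny : 0 < `|y| by rewrite normr_gt0.
have nx : 0 <= `|x| by [].
have h : 0 <= `| `|y| *: x - `|x| *: y| ^+ 2 by rewrite exprn_ge0.
have [x0|x0] := eqVneq x 0; first by rewrite x0 (ip0l Hip) normr0 mul0r.
have nx0 : 0 < `|x| by rewrite normr_gt0.
move: h; rewrite (sqrnormB Hip) !normrZ !normr_id (ipZl Hip) (ipZr Hip).
have -> : (`|y| * `|x|) ^+ 2 - 2 * (`|y| * (`|x| * ip x y)) + (`|x| * `|y|) ^+ 2
   = (2 * `|x| * `|y|) * (`|x| * `|y| - ip x y) by ring.
by rewrite pmulr_rge0 ?subr_ge0 // !mulr_gt0.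
Qed.

Lemma ip_continuous {R : realType} {H : completeNormedModType R}
  {ip : H -> H -> R} (Hip : is_inner_product ip) y :
  continuous (fun v => ip v y).
Proof.
move=> v; apply/cvgrPdist_le => e e0.
(* The [+ 1] keeps the divisor positive when [y = 0]. *)
have c0 : 0 < `|y| + 1 by rewrite ltr_wpDl.
have: \forall w \near v, `|v - w| <= e / (`|y| + 1).
  by apply: cvgr_dist_le; [exact: cvg_id | rewrite divr_gt0].
apply: filterS => w; rewrite ler_pdivlMr // => h.
rewrite -(ipBl Hip) ler_norml; apply/andP; split.
  rewrite lerNl -(ipNl Hip); apply: le_trans (ip_le_norm Hip _ _) _.
  by rewrite normrN; have : 0 <= `|v - w| by []; nra.
by apply: le_trans (ip_le_norm Hip _ _) _; have : 0 <= `|v - w| by []; nra.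
Qed.

Lemma halfspace_closed_midconvex {R : realType} {H : completeNormedModType R}
  {ip : H -> H -> R} (Hip : is_inner_product ip) y c :
  closed [set v | ip v y <= c] /\ midconvex [set v | ip v y <= c].
Proof.
split.
  apply: (@preimage_closed _ _ (fun v => ip v y) [set r | r <= c]).
    by move=> v _; exact: ip_continuous.
  exact: closed_le.
by move=> a b /=; rewrite (ipZl Hip) (ipDl Hip); lra.
Qed.

(** * Weak cluster points and Opial's argument *)

(** For n <= m the midpoint of [p n] and [p m] lies in [C n], so its squared norm is at least [D n],
    and the parallelogram identity bounds |p_n - p_m|^2 by 2 (D_m - D_n) + 4/(n+1). The infima [D]
    converge, being nondecreasing and at most [M ^+ 2]. *)
Lemma nested_closed_midconvex {R : realType} {H : completeNormedModType R}
    {ip : H -> H -> R} (Hip : is_inner_product ip) (C : nat -> set H)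
    (u : nat -> H) (M : R) :
    (forall n, closed (C n)) -> (forall n, midconvex (C n)) ->
    (forall n, C n.+1 `<=` C n) -> (forall n, C n (u n)) ->
    (forall n, `|u n| <= M) ->
  exists p, forall n, C n p.
Proof.
move=> Ccl Cmid Csub Cu uM.
have Cdec m n : (n <= m)%N -> C m `<=` C n.
  elim: m => [|m IH]; first by rewrite leqn0 => /eqP ->.
  rewrite leq_eqVlt => /predU1P[-> //|]; rewrite ltnS => /IH nm.
  by apply: subset_trans nm.
pose D n := inf [set `|v| ^+ 2 | v in C n].
have Dlb n : has_lbound [set `|v| ^+ 2 | v in C n].
  by exists 0 => _ [v _ <-]; rewrite exprn_ge0.
have Dle n v : C n v -> D n <= `|v| ^+ 2.
  by move=> Cv; apply: ge_inf => //; exists v.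
have Dn0 n : [set `|v| ^+ 2 | v in C n] !=set0 by exists (`|u n| ^+ 2), (u n).
have cD : cvgn D.
  apply: nondecreasing_is_cvgn.
    apply/nondecreasing_seqP => n; apply: lb_le_inf => // _ [v Cv <-].
    by apply: Dle; exact: Csub.
  exists (M ^+ 2) => _ [n _ <-]; apply: le_trans (Dle n _ (Cu n)) _.
  by rewrite ler_sqr ?nnegrE // (le_trans _ (uM n)).
have /choice[p pP] n : exists v, C n v /\ `|v| ^+ 2 < D n + n.+1%:R^-1.
  have [|_ [v Cv <-] vD] := @inf_adherent R _ n.+1%:R^-1 _ (conj (Dn0 n) (Dlb n)).
    by rewrite invr_gt0.
  by exists v.
have pdist n m : (n <= m)%N ->
    `|p n - p m| ^+ 2 <= 2 * (D m - D n) + 4 * n.+1%:R^-1.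
  move=> nm; have [Cn pn] := pP n; have [Cm pm] := pP m.
  have := Dle n _ (Cmid n _ _ Cn (Cdec _ _ nm _ Cm)).
  rewrite normrZ exprMn (sqrnormD Hip) (sqrnormB Hip) normfV ger0_norm //.
  have : m.+1%:R^-1 <= n.+1%:R^-1 :> R by rewrite lef_pV2 ?posrE // ler_nat.
  rewrite exprVn (_ : 2 ^+ 2 = 4 :> R); last by ring.
  move: pn pm; move: (D n) (D m) (n.+1%:R^-1) (m.+1%:R^-1) => *; lra.
have cp : cvgn p.
  apply: cauchy_cvg; apply: cauchy_exP => e e0.
  (* In units of e^2/8, [D m - D N] is below 2 and 1/(N+1) below 1, so the bound of [pdist] stays
     below 2 * 2 + 4 = 8 units. *)
  have e20 : 0 < e ^+ 2 / 8 by rewrite divr_gt0 // exprn_gt0.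
  have [N1 _ N1P] : \forall n \near \oo, `|limn D - D n| < e ^+ 2 / 8.
    by move/cvgrPdist_lt: cD; apply.
  have [N2 _ N2P] : \forall n \near \oo, `|0 - @harmonic R n| < e ^+ 2 / 8.
    by have /cvgrPdist_lt := @cvg_harmonic R; apply.
  pose N := maxn N1 N2; exists (p N).
  exists N => // m /= Nm; rewrite -ball_normE /ball_ /=.
  have := pdist _ _ Nm.
  have := N1P N (leq_maxl _ _); have := N2P N (leq_maxr _ _).
  have := N1P m (leq_trans (leq_maxl _ _) Nm).
  rewrite /= !ltr_norml => /andP[a1 a2] /andP[b1 b2] /andP[c1 c2] d.
  rewrite -ltr_sqr ?nnegrE // 1?ltW //.
  move: a1 a2 b1 b2 c1 c2 d; rewrite /harmonic /=.
  move: (limn D) (D N) (D m) (N.+1%:R^-1) (e ^+ 2) => *; lra.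
exists (limn p) => n; apply: (closed_cvg (C n)) cp => //.
by exists n => // m /= nm; apply: (Cdec _ _ nm); case: (pP m).
Qed.

(** [P] selects a subsequence. *)
Lemma bounded_cluster_hull {R : realType} {H : completeNormedModType R}
    {ip : H -> H -> R} (Hip : is_inner_product ip) (u : nat -> H) (M : R)
    (P : nat -> Prop) :
    (forall n, `|u n| <= M) -> (forall N, exists2 n, (N <= n)%N & P n) ->
  exists p, forall C : set H, closed C -> midconvex C ->
    (exists N, forall n, (N <= n)%N -> P n -> C (u n)) -> C p.
Proof.
move=> uM Pfreq.
have /choice[f fP] N : exists n, (N <= n)%N /\ P n.
  by have [n] := Pfreq N; exists n.
(* The closed midconvex hull of the selected terms of index at least [N], written as an
   intersection. *)
pose C N := [set v | forall K : set H, closed K -> midconvex K ->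
  (forall n, (N <= n)%N -> P n -> K (u n)) -> K v].
have [||||//|p pC] :=
    @nested_closed_midconvex R H ip Hip C (fun n => u (f n)) M.
- move=> n v vC K Kcl Kmid Ku; apply: (Kcl) => B /vC[w [wC wB]].
  by exists w; split; first exact: (wC _ Kcl Kmid Ku).
- by move=> n a b Ca Cb K Kcl Kmid Ku; apply: (Kmid); [exact: Ca|exact: Cb].
- by move=> n v Cv K Kcl Kmid Ku; apply: Cv => // m nm; apply: Ku; apply: ltnW.
- by move=> n K Kcl Kmid Ku; have [? ?] := fP n; apply: Ku.
by exists p => K Kcl Kmid [N Ku]; exact: (pC N).
Qed.

(** If cluster points q and xi both lie in [S], then <u_n, q - xi> converges, being affine in |u_n -
    xi|^2 - |u_n - q|^2. Evaluating at q and at xi gives this same limit, hence |q - xi|^2 = 0. *)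
Lemma opial {R : realType} {H : completeNormedModType R}
    {ip : H -> H -> R} (Hip : is_inner_product ip) (u : nat -> H) (M : R)
    (S : set H) :
    (forall n, `|u n| <= M) ->
    (forall p, S p -> cvgn (fun n => `|u n - p| ^+ 2)) ->
    (forall p, (forall C : set H, closed C -> midconvex C ->
       (\forall n \near \oo, C (u n)) -> C p) -> S p) ->
  exists2 p, S p & weak_cvg ip u p.
Proof.
move=> uM cvS hS.
have [|xi xiP] := @bounded_cluster_hull R H ip Hip u M (fun _ => True) uM.
  by move=> N; exists N.
have Sxi : S xi.
  by apply: hS => C ? ? [N _ NC]; apply: xiP => //; exists N => n ? _; exact: NC.
(* The lower bound follows from this upper one at [- y]. If the upper bound fails infinitely often,
   the failing indices have a cluster point q that a half-space keeps away from xi. *)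
have key y e : 0 < e -> \forall n \near \oo, ip (u n) y - ip xi y < e.
  move=> e0; apply: contrapT => nev.
  have [|q qP] := @bounded_cluster_hull R H ip Hip u M
      (fun n => e <= ip (u n) y - ip xi y) uM.
    move=> N; apply: contrapT => nex; apply: nev; exists N => // n /= Nn.
    by rewrite ltNge; apply/negP => en; apply: nex; exists n.
  have Sq : S q.
    by apply: hS => C ? ? [N _ NC]; apply: qP => //; exists N => n ? _; exact: NC.
  have yq : e <= ip q y - ip xi y.
    have [cl mid] := halfspace_closed_midconvex Hip (- y) (- (e + ip xi y)).
    have := qP _ cl mid; rewrite /= (ipNr Hip) => h; suff: - ip q y <= - (e + ip xi y) by lra.
    by apply: h; exists 0%N => n _; rewrite (ipNr Hip); lra.
  have cl : cvgn (fun n => ip (u n) (q - xi)).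
    have -> : (fun n => ip (u n) (q - xi)) = (fun n => 2^-1 *
        (`|u n - xi| ^+ 2 - `|u n - q| ^+ 2 - (`|xi| ^+ 2 - `|q| ^+ 2))).
      apply/funext => n; rewrite !(sqrnormB Hip) (ipBr Hip); lra.
    apply: is_cvgM; first exact: is_cvg_cst.
    apply: is_cvgB; last exact: is_cvg_cst.
    by apply: is_cvgB; exact: cvS.
  set l := limn (fun n => ip (u n) (q - xi)) in cl.
  (* Two opposite half-spaces, each containing a tail, confine the inner product to within [a] of
     [l]. *)
  have slab (p : H) (a : R) : 0 < a ->
      (forall C : set H, closed C -> midconvex C ->
        (\forall n \near \oo, C (u n)) -> C p) -> `|l - ip p (q - xi)| <= a.
    move=> a0 pC; have lim_near : \forall n \near \oo, `|l - ip (u n) (q - xi)| <= a.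
      by move/cvgrPdist_le: cl; apply.
    have [c1 m1] := halfspace_closed_midconvex Hip (q - xi) (l + a).
    have [c2 m2] := halfspace_closed_midconvex Hip (- (q - xi)) (a - l).
    have h1 : ip p (q - xi) <= l + a.
      apply: (pC _ c1 m1); apply: filterS lim_near => n /=.
      by rewrite ler_norml => /andP[]; lra.
    have h2 : ip p (- (q - xi)) <= a - l.
      apply: (pC _ c2 m2); apply: filterS lim_near => n /=.
      by rewrite ler_norml (ipNr Hip) => /andP[]; lra.
    by rewrite ler_norml; rewrite (ipNr Hip) in h2; apply/andP; split; lra.
  have qxi : `|q - xi| ^+ 2 <= 0.
    apply/ler_addgt0Pl => a a0; rewrite addr0.
    have h1 : `|l - ip q (q - xi)| <= a / 2.
      apply: slab; rewrite ?divr_gt0 // => C ? ? [N _ NC].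
      by apply: qP => //; exists N => n ? _; exact: NC.
    have h2 : `|l - ip xi (q - xi)| <= a / 2.
      apply: slab; rewrite ?divr_gt0 // => C ? ? [N _ NC].
      by apply: xiP => //; exists N => n ? _; exact: NC.
    move: h1 h2; rewrite !ler_norml => /andP[? ?] /andP[? ?].
    by rewrite -(ipxx Hip) [leLHS](ipBl Hip); lra.
  have : `|q - xi| = 0.
    by apply/eqP; rewrite -sqrf_eq0 eq_le qxi exprn_ge0.
  by move/normr0_eq0/subr0_eq => qE; move: yq; rewrite qE; lra.
exists xi => // y; apply/cvgrPdist_lt => e e0; near=> n.
rewrite ltr_norml; apply/andP; split.
  by have : ip (u n) y - ip xi y < e; [near: n; exact: key|lra].
have : ip (u n) (- y) - ip xi (- y) < e by near: n; exact: key.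
by rewrite !(ipNr Hip); lra.
Unshelve. all: by end_near. Qed.

(** * Gradient and proximal inequalities *)

Lemma le0_of_small {R : realType} (a b : R) :
  (forall t, 0 < t < 1 -> a <= t * b) -> a <= 0.
Proof.
move=> h; rewrite leNgt; apply/negP => a0.
have b0 : 0 < b by have := h 2^-1; lra.
have c0 : 0 < a + b by lra.
(* For this t, [t * b] is at most [a / 2], contradicting [a <= t * b]. *)
have := h (a / (2 * (a + b))).
have -> : a / (2 * (a + b)) * b = a / 2 * (b / (a + b)) by field; rewrite gt_eqF.
have h1 : b / (a + b) <= 1 by rewrite ler_pdivrMr //; lra.
have h2 : 0 < a / (2 * (a + b)) < 1.
  by rewrite divr_gt0 ?mulr_gt0 //= ltr_pdivrMr ?mulr_gt0 //; lra.
by move=> /(_ h2); nra.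
Qed.

Lemma le0_of_harmonic {R : realType} (a b : R) :
  (forall n, a <= b / n.+1%:R) -> a <= 0.
Proof.
move=> h; rewrite leNgt; apply/negP => a0.
have b0 : 0 < b by have := h 0%N; lra.
have := h (Num.bound (b / a)); rewrite ler_pdivlMr // mulrC -ler_pdivlMr //.
rewrite leNgt => /negP; apply.
apply: lt_le_trans (archi_boundP _) _; first by rewrite divr_ge0 // ltW.
by rewrite ler_nat.
Qed.

(** Reduces identities between linear combinations of vectors to ring
    identities between scalars. *)
Lemma ip_ext {R : realType} {H : completeNormedModType R}
  {ip : H -> H -> R} (Hip : is_inner_product ip) u v :
  (forall h, ip u h = ip v h) -> u = v.
Proof.
move=> uv; apply/eqP; rewrite -subr_eq0 -normr_eq0 -sqrf_eq0 -(ipxx Hip).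
by rewrite (ipBl Hip) uv subrr.
Qed.

(** By convexity the difference quotients of [Phi] at [y] towards [u] are at most [Phi u - Phi y]
    for steps in (0, 1]; the derivative is their limit from the right. *)
Lemma gradient_inequality {R : realType} {H : completeNormedModType R}
    {ip : H -> H -> R} (Phi : H -> R) (G : H -> H) (y u : H) :
    convex_real Phi -> differentiable Phi y ->
    (forall h, 'd Phi y h = ip (G y) h) ->
  Phi y + ip (G y) (u - y) <= Phi u.
Proof.
move=> cvx dPhi dE; rewrite -dE -deriveE // -lerBrDl.
have := cvg_dnbhs_at_right (diff_derivable (v := u - y) dPhi).
move/cvgr_to_le; apply; near=> h.
have h0 : 0 < h by [].
rewrite ler_pdivrMl //= (_ : _ + y = h *: u + (1 - h) *: y).
  have : 0 <= h <= 1 by rewrite ltW //=; near: h; exact: nbhs_right_le.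
  by move/(cvx u y h); lra.
by rewrite scalerBr scalerBl scale1r addrAC addrA.
Unshelve. all: by end_near. Qed.

(** Subdividing [y, p] and using the subgradient inequality at each node gives
    the quadratic bound without integrating the gradient. *)
Lemma descent_lemma {R : realType} {H : completeNormedModType R}
    {ip : H -> H -> R} (Hip : is_inner_product ip) (Phi : H -> R) (G : H -> H)
    (L : R) (y p : H) :
    (forall a b, Phi a + ip (G a) (b - a) <= Phi b) ->
    (forall a b, `|G a - G b| <= L * `|a - b|) ->
  Phi p <= Phi y + ip (G y) (p - y) + L / 2 * `|p - y| ^+ 2.
Proof.
move=> hsub hlip; set d := p - y.
pose Q := L * `|d| ^+ 2.
suff step n : Phi p - (Phi y + ip (G y) d + Q / 2) <= (Q / 2) / n.+1%:R.
  by have := le0_of_harmonic _ _ step; rewrite /Q; lra.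
pose a i : H := y + (i%:R / n.+1%:R) *: d.
have N0 : n.+1%:R != 0 :> R by rewrite pnatr_eq0.
(* Beyond the linear part, passing from node i to node i+1 costs Q (i+1)/(n+1)^2: the subgradient
   inequality is taken at the far node, whose gradient is compared with [G y]. At i = n+1 the total
   cost is Q/2 + Q/(2(n+1)). *)
have hi i : Phi (a i) <= Phi y + i%:R / n.+1%:R * ip (G y) d
     + Q * (i%:R * i.+1%:R) / (2 * n.+1%:R ^+ 2).
  elim: i => [|i IH]; first by rewrite /a !mul0r scale0r !mulr0 !mul0r !addr0.
  have aS : a i.+1 = a i + n.+1%:R^-1 *: d.
    by rewrite /a -addrA -scalerDl; congr (_ + _ *: _); rewrite -natr1; field.
  have h1 := hsub (a i.+1) (a i).
  have h2 : ip (G (a i.+1)) (a i - a i.+1) = - n.+1%:R^-1 * ip (G (a i.+1)) d.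
    by rewrite aS opprD addNKr (ipNr Hip) (ipZr Hip) mulNr.
  have h3 : ip (G (a i.+1)) d <= ip (G y) d + i.+1%:R / n.+1%:R * Q.
    have -> : ip (G (a i.+1)) d = ip (G y) d + ip (G (a i.+1) - G y) d.
      by rewrite (ipBl Hip); ring.
    rewrite lerD2l; apply: le_trans (ip_le_norm Hip _ _) _.
    apply: le_trans (ler_wpM2r _ (hlip _ _)) _ => //.
    rewrite /a addrAC subrr add0r normrZ ger0_norm ?divr_ge0 // /Q.
    by rewrite le_eqVlt; apply/orP; left; apply/eqP; ring.
  have {}h3 := ler_wpM2l (_ : 0 <= n.+1%:R^-1) h3.
  rewrite h2 in h1; have {}h3 := h3 _; rewrite invr_ge0 in h3.
  have {}h3 := h3 (ler0n _ _).
  apply: (@le_trans _ _ (Phi (a i) + n.+1%:R^-1 * (ip (G y) d + i.+1%:R / n.+1%:R * Q))).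
    move: h1 h3; move: (n.+1%:R^-1) (_ * (ip (G y) d + _)) => c q h1 h3; lra.
  apply: (le_trans (lerD IH (lexx _))).
  rewrite le_eqVlt; apply/orP; left; apply/eqP.
  by rewrite -[i.+2%:R]natr1 -[i.+1%:R]natr1; field.
have := hi n.+1.
have -> : a n.+1 = p by rewrite /a divff // scale1r addrC subrK.
rewrite divff // mul1r => h; rewrite lerBlDl; apply: (le_trans h).
rewrite le_eqVlt; apply/orP; left; apply/eqP.
by rewrite -[n.+2%:R]natr1; field.
Qed.

Lemma prox_fin_num {R : realType} {H : completeNormedModType R} (s : R)
    (Psi : H -> \bar R) (z p : H) :
  proper_fun Psi -> is_prox s Psi z p -> Psi p \is a fin_num.
Proof.
move=> [noo [u u_fin]] /(_ u) /=; rewrite fin_numE noo /=.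
by case: (Psi u) u_fin (noo u) => // r _ _; case: (Psi p).
Qed.

(** Minimality of [p] is tested against t u + (1 - t) p; after division by t the remaining quadratic
    term is of order t. Thus (z - p)/s is a subgradient of [Psi] at [p]. *)
Lemma prox_subgradient {R : realType} {H : completeNormedModType R}
    {ip : H -> H -> R} (Hip : is_inner_product ip) (s : R)
    (Psi : H -> \bar R) (z p u : H) :
    0 < s -> convex_ext Psi -> is_prox s Psi z p ->
    Psi p \is a fin_num -> Psi u \is a fin_num ->
  fine (Psi p) + s^-1 * ip (z - p) (u - p) <= fine (Psi u).
Proof.
move=> s0 cvx prox /fineK/esym pE /fineK/esym uE.
set a := fine (Psi p) in pE *; set b := fine (Psi u) in uE *.
suff : a + s^-1 * ip (z - p) (u - p) - b <= 0 by lra.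
apply: (le0_of_small _ ((2 * s)^-1 * `|u - p| ^+ 2)) => t t01.
have := cvx u p t t01; rewrite /= pE uE -!EFinM -EFinD.
set v := t *: u + (1 - t) *: p => vle.
have := prox v; rewrite /= pE => ple.
have {ple}: ((a + (2 * s)^-1 * `|p - z| ^+ 2)%:E <=
    (t * b + (1 - t) * a)%:E + ((2 * s)^-1 * `|v - z| ^+ 2)%:E)%E.
  by rewrite EFinD; apply: le_trans ple _; rewrite leeD2r.
rewrite -EFinD lee_fin.
have -> : v - z = t *: (u - p) - (z - p).
  by apply: (ip_ext Hip) => h; rewrite /v !(ipDl Hip, ipNl Hip, ipZl Hip); ring.
rewrite (distrC p z) (sqrnormB Hip (t *: _)) (ipZl Hip) (ipC Hip (u - p)) normrZ exprMn.
have -> : `|t| ^+ 2 = t ^+ 2 by rewrite real_normK // num_real.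
move: (ip _ _) (`|u - p| ^+ 2) (`|z - p| ^+ 2) => c q r h.
have t0 : 0 < t by case/andP: t01.
rewrite -subr_ge0 -(pmulr_rge0 _ t0); move: h; rewrite -subr_ge0.
set l := (X in 0 <= X -> _); set m := (X in _ -> 0 <= X).
by suff -> : l = m by []; rewrite /l /m; field; rewrite gt_eqF.
Qed.

(** Sum of the proximal subgradient inequality at [p], the gradient inequality from [y] to [u] and
    the descent lemma from [y] to [p]. The point [u] stays free, to be taken as an iterate or as a
    minimizer. *)
Lemma forward_backward_inequality {R : realType} {H : completeNormedModType R}
    {ip : H -> H -> R} (Hip : is_inner_product ip) (Psi : H -> \bar R)
    (Phi : H -> R) (G : H -> H) (L s : R) (y g p u : H) :
    0 < s -> convex_ext Psi ->
    (forall a b, Phi a + ip (G a) (b - a) <= Phi b) ->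
    (forall a b, `|G a - G b| <= L * `|a - b|) ->
    is_prox s Psi (y - s *: (G y - g)) p ->
    Psi p \is a fin_num -> Psi u \is a fin_num ->
  fine (Psi p) + Phi p <= fine (Psi u) + Phi u + s^-1 * ip (y - p) (p - u) +
    ip g (p - u) + L / 2 * `|p - y| ^+ 2.
Proof.
move=> s0 cvx hsub hlip prox pfin ufin.
have := prox_subgradient Hip _ _ _ _ _ s0 cvx prox pfin ufin.
have := hsub y u; have := descent_lemma Hip _ _ _ y p hsub hlip.
have -> : s^-1 * ip (y - s *: (G y - g) - p) (u - p) =
   - (s^-1 * ip (y - p) (p - u)) + ip (G y) (p - y) - ip (G y) (u - y) - ip g (p - u).
  by rewrite !(ipDl Hip, ipDr Hip, ipNl Hip, ipNr Hip, ipZl Hip); field; rewrite gt_eqF.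
lra.
Qed.

(** * One-step energy estimates *)

Lemma three_point {R : realType} {H : completeNormedModType R}
  {ip : H -> H -> R} (Hip : is_inner_product ip) a b c :
  ip (a - b) (b - c) = (`|a - c| ^+ 2 - `|b - c| ^+ 2 - `|b - a| ^+ 2) / 2.
Proof.
rewrite !(sqrnormB Hip) !(ipDl Hip, ipDr Hip, ipNl Hip, ipNr Hip) !(ipxx Hip).
by rewrite (ipC Hip b a); field.
Qed.

(** Weights [t] and [lam] combine the right-hand vectors into w', while (t + lam)(y - x2) = w - w'.
    The inner product thus becomes a difference of squares whose leftover -|w - w'|^2/(2s) absorbs
    the smoothness term, as s L <= 1. *)
Lemma energy_step {R : realType} {H : completeNormedModType R}
    {ip : H -> H -> R} (Hip : is_inner_product ip) (x0 x1 x2 z g : H)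
    (t lam s L th1 th2 : R) :
    let y := x1 + ((t - 1) / (t + lam)) *: (x1 - x0) in
    let w := (t - 1 + lam) *: (x1 - z) - (t - 1) *: (x0 - z) in
    let w' := (t + lam) *: (x2 - z) - t *: (x1 - z) in
    0 < t -> 0 < lam -> 0 < s -> s * L <= 1 ->
    th2 <= th1 + s^-1 * ip (y - x2) (x2 - x1) + ip g (x2 - x1) +
             L / 2 * `|x2 - y| ^+ 2 ->
    th2 <= s^-1 * ip (y - x2) (x2 - z) + ip g (x2 - z) +
             L / 2 * `|x2 - y| ^+ 2 ->
  (t + lam) ^+ 2 * th2 + (2 * s)^-1 * `|w'| ^+ 2 <=
  t * (t + lam) * th1 + (2 * s)^-1 * `|w| ^+ 2 + (t + lam) * (`|g| * `|w'|).
Proof.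
move=> y w w' t0 lam0 s0 sL h1 h2.
have N0 : 0 < t + lam by rewrite addr_gt0.
have w'E : w' = t *: (x2 - x1) + lam *: (x2 - z).
  by apply: (ip_ext Hip) => h; rewrite !(ipDl Hip, ipNl Hip, ipZl Hip); ring.
have yE : (t + lam) *: (y - x2) = w - w'.
  apply: (ip_ext Hip) => h; rewrite /y !(ipDl Hip, ipNl Hip, ipZl Hip).
  by field; rewrite gt_eqF.
have h12 : (t + lam) * th2 <= t * th1 + s^-1 * ip (y - x2) w' + ip g w' +
     (t + lam) * (L / 2 * `|x2 - y| ^+ 2).
  rewrite w'E !(ipDr Hip w', ipDr Hip (t *: _), ipZr Hip).
  by have := ler_wpM2l (ltW t0) h1; have := ler_wpM2l (ltW lam0) h2; lra.
have {}h12 := ler_wpM2l (ltW N0) h12.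
have ipE : (t + lam) * ip (y - x2) w' =
    (`|w| ^+ 2 - `|w'| ^+ 2 - `|w - w'| ^+ 2) / 2.
  by rewrite -(ipZl Hip) yE (sqrnormB Hip w) (ipBl Hip) (ipxx Hip); field.
have nE : (t + lam) ^+ 2 * `|x2 - y| ^+ 2 = `|w - w'| ^+ 2.
  by rewrite -yE normrZ exprMn distrC real_normK // num_real.
have gE := ler_wpM2l (ltW N0) (ip_le_norm Hip g w').
have Ls : L / 2 <= (2 * s)^-1.
  rewrite invfM mulrC ler_pM2l ?invr_gt0 //.
  by rewrite -[leRHS]mul1r ler_pdivlMr // mulrC.
have Ln := ler_wpM2r (exprn_ge0 2 (normr_ge0 (w - w'))) Ls.
have e1 : (t + lam) * (t * th1 + s^-1 * ip (y - x2) w' + ip g w' +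
       (t + lam) * (L / 2 * `|x2 - y| ^+ 2)) =
   t * (t + lam) * th1 + (2 * s)^-1 * (`|w| ^+ 2 - `|w'| ^+ 2 - `|w - w'| ^+ 2) +
   (t + lam) * ip g w' + L / 2 * `|w - w'| ^+ 2.
  rewrite -nE; have -> : (2 * s)^-1 * (`|w| ^+ 2 - `|w'| ^+ 2 - (t + lam) ^+ 2 * `|x2 - y| ^+ 2)
    = s^-1 * ((t + lam) * ip (y - x2) w').
    by rewrite ipE nE; field; rewrite gt_eqF.
  by ring.
rewrite e1 in h12; rewrite expr2 -mulrA; lra.
Qed.

(** Combines the three-point identity with (t + lam)(y - x1) = (t - 1)(x1 - x0). The incoming
    velocity gets the factor (t - 1)^2 instead of (t - 1 + lam)^2: this is the dissipation exploited
    in [inertial_decay]. *)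
Lemma velocity_step {R : realType} {H : completeNormedModType R}
    {ip : H -> H -> R} (Hip : is_inner_product ip) (x0 x1 x2 g : H)
    (t lam s L th1 th2 : R) :
    let y := x1 + ((t - 1) / (t + lam)) *: (x1 - x0) in
    0 < t + lam -> 0 < s -> s * L <= 1 ->
    th2 <= th1 + s^-1 * ip (y - x2) (x2 - x1) + ip g (x2 - x1) +
             L / 2 * `|x2 - y| ^+ 2 ->
  (t + lam) ^+ 2 * (th2 + (2 * s)^-1 * `|x2 - x1| ^+ 2) <=
  (t + lam) ^+ 2 * th1 + (t - 1) ^+ 2 * ((2 * s)^-1 * `|x1 - x0| ^+ 2) +
  (t + lam) ^+ 2 * (`|g| * `|x2 - x1|).
Proof.
move=> y N0 s0 sL h1.
have gE := ip_le_norm Hip g (x2 - x1).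
have Ls : L / 2 <= (2 * s)^-1.
  rewrite invfM mulrC ler_pM2l ?invr_gt0 //.
  by rewrite -[leRHS]mul1r ler_pdivlMr // mulrC.
have Ln := ler_wpM2r (exprn_ge0 2 (normr_ge0 (x2 - y))) Ls.
have -> : (t - 1) ^+ 2 * ((2 * s)^-1 * `|x1 - x0| ^+ 2) =
    (t + lam) ^+ 2 * ((2 * s)^-1 * `|y - x1| ^+ 2).
  rewrite /y addrAC subrr add0r normrZ exprMn real_normK ?num_real //.
  by field; rewrite !gt_eqF.
rewrite -!mulrDr ler_pM2l ?exprn_gt0 //.
have e1 : s^-1 * ip (y - x2) (x2 - x1) =
   (2 * s)^-1 * `|y - x1| ^+ 2 - (2 * s)^-1 * `|x2 - x1| ^+ 2 - (2 * s)^-1 * `|x2 - y| ^+ 2.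
  by rewrite (three_point Hip); field; rewrite gt_eqF.
lra.
Qed.

(** * Asymptotics of the inertial sequence *)

(** [X n], [th n] and [gam n] stand for x_{n+1}, theta_{n+2} and g_{n+2}: the
    shift discards x_0 and x_1, where Psi may be infinite. *)
Lemma inertial_energy {R : realType} {H : completeNormedModType R}
    {ip : H -> H -> R} (Hip : is_inner_product ip) (X gam : nat -> H)
    (th : nat -> R) (lam s L B : R) (z : H) :
    let y n := X n.+1 + (n.+1%:R / (n.+2%:R + lam)) *: (X n.+1 - X n) in
    let w n := (n.+1%:R + lam) *: (X n.+1 - z) - n.+1%:R *: (X n - z) in
    2 < lam -> 0 < s -> s * L <= 1 -> (forall n, 0 <= th n) ->
    (forall n, th n.+1 <= th n + s^-1 * ip (y n - X n.+2) (X n.+2 - X n.+1) +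
       ip (gam n) (X n.+2 - X n.+1) + L / 2 * `|X n.+2 - y n| ^+ 2) ->
    (forall n, th n.+1 <= s^-1 * ip (y n - X n.+2) (X n.+2 - z) +
       ip (gam n) (X n.+2 - z) + L / 2 * `|X n.+2 - y n| ^+ 2) ->
    (forall n, \sum_(0 <= j < n) j.+2%:R * `|gam j| <= B) ->
  [/\ exists W, forall n, `|w n| <= W,
      exists K, forall n, \sum_(0 <= j < n) j.+1%:R * th j <= K &
      cvgn (fun n => (n.+1%:R + lam) ^+ 2 * th n + (2 * s)^-1 * `|w n| ^+ 2)].
Proof.
move=> y w lam2 s0 sL th0 hstep hmin hgam.
have tS n : n.+2%:R = n.+1%:R + 1 :> R by rewrite natr1.
have t0 n : 1 <= n.+1%:R :> R by rewrite ler1n.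
pose e n := (n.+1%:R + lam) ^+ 2 * th n + (2 * s)^-1 * `|w n| ^+ 2.
(* The coefficient is (t - 1 + lam)^2 - t (t + lam) at t = n + 2; here [2 < lam], that is alpha > 3,
   enters. *)
pose r n := ((lam - 2) * n.+2%:R + (lam - 1) ^+ 2) * th n.
pose b n := (n.+2%:R + lam) * `|gam n|.
have s20 : 0 < (2 * s)^-1 by rewrite invr_gt0 mulr_gt0.
have e0 n : 0 <= e n.
  by apply: addr_ge0; apply: mulr_ge0; rewrite ?exprn_even_ge0 // ltW.
have r0 n : 0 <= r n.
  apply: mulr_ge0 => //; apply: addr_ge0; last exact: exprn_even_ge0.
  by apply: mulr_ge0 => //; lra.
have b0 n : 0 <= b n by rewrite mulr_ge0 // addr_ge0 //; lra.
have estep n : e n.+1 + r n <= e n + b n * `|w n.+1|.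
  have tm : n.+2%:R - 1 = n.+1%:R :> R by rewrite tS addrK.
  have := @energy_step R H ip Hip (X n) (X n.+1) (X n.+2) z (gam n) n.+2%:R
    lam s L (th n) (th n.+1).
  rewrite /= tm => /(_ (ltr0Sn _ _) (lt_trans (ltr0Sn _ 1) lam2) s0 sL (hstep n) (hmin n)).
  rewrite -/(w n) -/(w n.+1) /e /r /b tS.
  move: (`|w n.+1|) ((2 * s)^-1 * `|w n| ^+ 2) (th n) (`|gam n|) (n.+1%:R) => *; lra.
have bB n : \sum_(0 <= j < n) b j <= (1 + lam) * B.
  apply: (@le_trans _ _ (\sum_(0 <= j < n) (1 + lam) * (j.+2%:R * `|gam j|))).
    apply: ler_sum => j _; rewrite mulrA ler_wpM2r //.
    have := t0 j.+1; nra.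
  by rewrite -mulr_sumr ler_wpM2l //; lra.
have elt n : e n <= e 0%N + \sum_(0 <= j < n) b j * `|w j.+1|.
  elim: n => [|n IH]; first by rewrite big_nil addr0.
  by rewrite big_nat_recr //=; have := estep n; have := r0 n; lra.
have [W hW] : exists W, forall n, `|w n| <= W.
  (* Since e_n >= |w_n|^2/(2s), multiplying [elt] by 2s puts it in Gronwall form with C = 2s e_0. *)
  exists (1 + 2 * s * e 0%N + 2 * s * ((1 + lam) * B)).
  apply: (@discrete_gronwall _ _ (fun n => 2 * s * b n)) => //.
  - by move=> n; rewrite mulr_ge0 // mulr_ge0 // ltW.
  - by rewrite mulr_ge0 // mulr_ge0 // ltW.
  - rewrite -ler_pdivrMl ?mulr_gt0 // lerDr mulr_ge0 //.
    by rewrite exprn_ge0 // addr_ge0 //; lra.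
  - by move=> n; rewrite -mulr_sumr ler_wpM2l // mulr_ge0 // ltW.
  - move=> n; under eq_bigr do rewrite -mulrA.
    rewrite -mulr_sumr -mulrDr -ler_pdivrMl ?mulr_gt0 //.
    apply: le_trans (elt n.+1); rewrite lerDr mulr_ge0 //.
    by rewrite exprn_ge0 // addr_ge0 //; lra.
(* With [w] bounded by [W], the errors become summable. *)
have [||||| ce rB] := @quasi_descent _ e r (fun n => b n * W) ((1 + lam) * B * W).
- by [].
- by [].
- by move=> n; rewrite mulr_ge0 // (le_trans _ (hW 0%N)).
- by move=> n; rewrite -mulr_suml ler_wpM2r // (le_trans _ (hW 0%N)).
- by move=> n; apply: le_trans (estep n) _; rewrite lerD2l ler_wpM2l.
split=> //; first by exists W.
exists ((e 0%N + (1 + lam) * B * W) / (lam - 2)) => n.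
have l2 : 0 < lam - 2 by lra.
rewrite ler_pdivlMr // mulrC mulr_sumr; apply: le_trans (rB n).
apply: ler_sum => j _; rewrite /r mulrA ler_wpM2r // tS.
have : 0 <= (lam - 1) ^+ 2 by rewrite exprn_even_ge0.
nra.
Qed.

(** From (n+1+lam) |X_{n+1} - z| <= W + (n+1) |X_n - z|, any bound M with lam M >= W is inherited;
    this explains [W / lam]. *)
Lemma inertial_bounded {R : realType} {H : completeNormedModType R}
    (X : nat -> H) (lam W : R) (z : H) :
    0 < lam ->
    (forall n, `|(n.+1%:R + lam) *: (X n.+1 - z) - n.+1%:R *: (X n - z)| <= W) ->
  exists M, forall n, `|X n - z| <= M.
Proof.
move=> lam0 hW; have W0 : 0 <= W by apply: le_trans (hW 0%N).
exists (`|X 0%N - z| + W / lam) => n.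
elim: n => [|n IH]; first by rewrite lerDl divr_ge0 // ltW.
have N0 : 0 < n.+1%:R + lam by rewrite addr_gt0.
rewrite -(ler_pM2l N0) -[X in X * `|_|](ger0_norm (ltW N0)) -normrZ.
rewrite -[X in `|X|](subrK (n.+1%:R *: (X n - z))).
apply: le_trans (ler_normD _ _) _; apply: le_trans (lerD (hW n) (lexx _)) _.
rewrite normrZ normr_nat; have {}IH := ler_wpM2l (ler0n R n.+1) IH.
have WE : lam * (W / lam) = W by rewrite mulrC divfK // gt_eqF.
have X0 : 0 <= lam * `|X 0%N - z| by rewrite mulr_ge0 // ltW.
rewrite mulrDl [lam * _]mulrDr WE; lra.
Qed.

Lemma inertial_split {R : realType} {H : completeNormedModType R}
    {ip : H -> H -> R} (Hip : is_inner_product ip) (x0 x1 z : H) (t lam : R) :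
  (t + lam) *: (x1 - z) - t *: (x0 - z) = lam *: (x1 - z) + t *: (x1 - x0).
Proof. by apply: (ip_ext Hip) => h; rewrite !(ipDl Hip, ipNl Hip, ipZl Hip); ring. Qed.

Lemma inertial_decay {R : realType} {H : completeNormedModType R}
    {ip : H -> H -> R} (Hip : is_inner_product ip) (X gam : nat -> H)
    (th : nat -> R) (lam s L B K V : R) :
    let y n := X n.+1 + (n.+1%:R / (n.+2%:R + lam)) *: (X n.+1 - X n) in
    2 < lam -> 0 < s -> s * L <= 1 -> (forall n, 0 <= th n) ->
    (forall n, th n.+1 <= th n + s^-1 * ip (y n - X n.+2) (X n.+2 - X n.+1) +
       ip (gam n) (X n.+2 - X n.+1) + L / 2 * `|X n.+2 - y n| ^+ 2) ->
    (forall n, \sum_(0 <= j < n) j.+2%:R * `|gam j| <= B) ->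
    (forall n, \sum_(0 <= j < n) j.+1%:R * th j <= K) ->
    (forall n, n.+1%:R * `|X n.+1 - X n| <= V) ->
  (fun n => (n.+1%:R + lam) ^+ 2 * (th n + (2 * s)^-1 * `|X n.+1 - X n| ^+ 2))
    @ \oo --> (0 : R).
Proof.
move=> y lam2 s0 sL th0 hstep hgam hK hV.
have tS n : n.+2%:R = n.+1%:R + 1 :> R by rewrite natr1.
have t0 n : 1 <= n.+1%:R :> R by rewrite ler1n.
have s20 : 0 < (2 * s)^-1 by rewrite invr_gt0 mulr_gt0.
pose D n := (2 * s)^-1 * `|X n.+1 - X n| ^+ 2.
have D0 n : 0 <= D n by apply: mulr_ge0; [exact: ltW | exact: exprn_ge0].
pose G n := (n.+1%:R + lam) ^+ 2 * (th n + D n).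
have G0 n : 0 <= G n by apply: mulr_ge0; rewrite ?exprn_even_ge0 ?addr_ge0.
(* The factor is (n+1+lam)^2 - (n+1)^2. *)
pose r n := lam * (2 * n.+1%:R + lam) * D n.
(* The first term dominates the growth (n+2+lam)^2 - (n+1+lam)^2 of the weight on [th n]; the second
   uses n+2+lam <= (1+lam)(n+2) and the velocity bound [V]. *)
pose b n := (3 + 2 * lam) * (n.+1%:R * th n)
   + (1 + lam) ^+ 2 * V * (n.+2%:R * `|gam n|).
have V0 : 0 <= V by apply: le_trans (hV 0%N); rewrite mulr_ge0.
have r0 n : 0 <= r n.
  by rewrite mulr_ge0 // mulr_ge0 //; [lra | have := t0 n; lra].
have b0 n : 0 <= b n.
  have c0 : 0 <= (1 + lam) ^+ 2 by exact: exprn_even_ge0.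
  by apply: addr_ge0; apply: mulr_ge0; rewrite ?mulr_ge0 //; lra.
have bB n : \sum_(0 <= j < n) b j <= (3 + 2 * lam) * K + (1 + lam) ^+ 2 * V * B.
  rewrite big_split /= -!mulr_sumr lerD // ler_wpM2l //; first lra.
  by rewrite mulr_ge0 // exprn_even_ge0.
have Gstep n : G n.+1 + r n <= G n + b n.
  have tm : n.+2%:R - 1 = n.+1%:R :> R by rewrite tS addrK.
  have := @velocity_step R H ip Hip (X n) (X n.+1) (X n.+2) (gam n) n.+2%:R
    lam s L (th n) (th n.+1).
  have N0 : 0 < n.+2%:R + lam by rewrite addr_gt0 //; lra.
  rewrite /= tm => /(_ N0 s0 sL (hstep n)).
  rewrite -/(D n) -/(D n.+1) -/(G n.+1) => h.
  have hb : (n.+2%:R + lam) ^+ 2 * (`|gam n| * `|X n.+2 - X n.+1|) <=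
      (1 + lam) ^+ 2 * V * (n.+2%:R * `|gam n|).
    apply: (@le_trans _ _ (((1 + lam) * n.+2%:R) ^+ 2 * (`|gam n| * `|X n.+2 - X n.+1|))).
      rewrite ler_wpM2r ?mulr_ge0 // ler_sqr ?nnegrE //.
      - by have := t0 n.+1; nra.
      - exact: ltW.
      - by rewrite mulr_ge0 //; lra.
    have -> : ((1 + lam) * n.+2%:R) ^+ 2 * (`|gam n| * `|X n.+2 - X n.+1|) =
      (1 + lam) ^+ 2 * (n.+2%:R * `|X n.+2 - X n.+1|) * (n.+2%:R * `|gam n|).
      by ring.
    by rewrite ler_wpM2r ?mulr_ge0 // ler_wpM2l ?exprn_even_ge0.
  have ht : (2 * n.+1%:R + 2 * lam + 1) * th n <= (3 + 2 * lam) * (n.+1%:R * th n).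
    by rewrite mulrA ler_wpM2r //; have := t0 n; nra.
  rewrite /G /r /b; move: h ht hb; rewrite /G tS.
  move: (th n) (D n) (th n.+1 + D n.+1) (`|gam n|) (`|X n.+2 - X n.+1|) (n.+1%:R).
  move=> *; lra.
have [||||| cG rB] := @quasi_descent _ G r b ((3 + 2 * lam) * K + (1 + lam) ^+ 2 * V * B).
- by [].
- by [].
- by [].
- by [].
- by [].
have lam0 : 0 < lam by lra.
set B' := (3 + 2 * lam) * K + _ in rB.
(* G_j/(j+1) is at most (1+lam)^2 (j+1) (th_j + D_j), and (j+1) D_j <= r_j/(2 lam) has bounded sums
   by [rB]. *)
apply: (@cvg0_of_sum_harmonic _ G ((1 + lam) ^+ 2 * (K + (G 0%N + B') / (2 * lam)))) => // n.
apply: (@le_trans _ _ ((1 + lam) ^+ 2 *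
   (\sum_(0 <= j < n) j.+1%:R * th j + (\sum_(0 <= j < n) r j) / (2 * lam)))).
  rewrite mulr_suml -big_split /= mulr_sumr; apply: ler_sum => j _.
  rewrite ler_pdivrMr //.
  have h1 : (j.+1%:R + lam) ^+ 2 <= ((1 + lam) * j.+1%:R) ^+ 2.
    rewrite ler_sqr ?nnegrE //; first by have := t0 j; nra.
      by rewrite addr_ge0 // ltW.
    by rewrite mulr_ge0 //; lra.
  have h2 : j.+1%:R * D j <= r j / (2 * lam).
    rewrite ler_pdivlMr ?mulr_gt0 // /r.
    have := mulr_ge0 (exprn_ge0 2 (ltW lam0)) (D0 j); lra.
  apply: (le_trans (ler_wpM2r (addr_ge0 (th0 j) (D0 j)) h1)).
  have -> : ((1 + lam) * j.+1%:R) ^+ 2 * (th j + D j) =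
     (1 + lam) ^+ 2 * (j.+1%:R * th j + j.+1%:R * D j) * j.+1%:R by ring.
  by rewrite ler_wpM2r // ler_wpM2l ?exprn_even_ge0 // lerD2l.
rewrite ler_wpM2l ?exprn_even_ge0 // lerD // ler_wpM2r //.
by rewrite invr_ge0 mulr_ge0 // ltW.
Qed.

(** Expand the square of lam (X_{n+1} - z) = w_n - v_n, with v_n = (n+1)(X_{n+1} - X_n) tending to
    0: as [w] is bounded, the cross term vanishes in the limit. *)
Lemma inertial_dist_cvg {R : realType} {H : completeNormedModType R}
    {ip : H -> H -> R} (Hip : is_inner_product ip) (X : nat -> H)
    (lam W : R) (z : H) :
    let w n := (n.+1%:R + lam) *: (X n.+1 - z) - n.+1%:R *: (X n - z) in
    0 < lam -> (forall n, `|w n| <= W) -> cvgn (fun n => `|w n| ^+ 2) ->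
    (fun n => n.+1%:R * `|X n.+1 - X n|) @ \oo --> (0 : R) ->
  cvgn (fun n => `|X n.+1 - z| ^+ 2).
Proof.
move=> w lam0 hW cw v0.
pose v n := n.+1%:R *: (X n.+1 - X n).
have vE n : `|v n| = n.+1%:R * `|X n.+1 - X n| by rewrite normrZ normr_nat.
have {}v0 : (fun n => `|v n|) @ \oo --> (0 : R) by under eq_fun do rewrite vE.
have wv n : w n - v n = lam *: (X n.+1 - z).
  by rewrite /w (inertial_split Hip) addrK.
have -> : (fun n => `|X n.+1 - z| ^+ 2) = (fun n => (lam ^+ 2)^-1 *
    (`|w n| ^+ 2 - 2 * ip (w n) (v n) + `|v n| * `|v n|)).
  apply/funext => n; rewrite -expr2 -(sqrnormB Hip) wv normrZ exprMn.
  by rewrite gtr0_norm // mulKf // expf_neq0 // gt_eqF.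
have ipwv : (fun n => ip (w n) (v n)) @ \oo --> (0 : R).
  have lo : (fun n => - (W * `|v n|)) @ \oo --> (0 : R).
    by rewrite -oppr0 -[in X in _ --> X](mulr0 W); apply: cvgN; apply: cvgMr.
  have hi : (fun n => W * `|v n|) @ \oo --> (0 : R).
    by rewrite -[in X in _ --> X](mulr0 W); apply: cvgMr.
  apply: squeeze_cvgr lo hi; near=> n.
  have hb (q : H) : `|q| = `|v n| -> ip (w n) q <= W * `|v n|.
    by move=> qv; apply: le_trans (ip_le_norm Hip _ _) _; rewrite qv ler_wpM2r.
  by rewrite lerNl -(ipNr Hip) !hb // normrN.
apply: is_cvgM; first exact: is_cvg_cst.
apply: is_cvgD; last by apply: is_cvgM; apply: cvgP v0.
apply: is_cvgB => //; apply: is_cvgM; first exact: is_cvg_cst.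
exact: cvgP ipwv.
Unshelve. all: by end_near. Qed.

(** * Sublevel sets and auxiliary facts on limits and sums *)

Lemma sublevel_closed_midconvex {R : realType} {H : completeNormedModType R}
    (Psi : H -> \bar R) (Phi : H -> R) (c : R) :
    (forall v, Psi v != -oo%E) -> lower_semicontinuous Psi -> convex_ext Psi ->
    continuous Phi -> convex_real Phi ->
  let C := [set v | (Psi v + (Phi v)%:E <= c%:E)%E] in closed C /\ midconvex C.
Proof.
move=> noo lsc cvxPsi ctsPhi cvxPhi C; split.
  move=> v vcl; rewrite /C /= leNgt; apply/negP => cv.
  (* A real [a] strictly between [c - Phi v] and [Psi v] splits the strict inequality into two open
     conditions, one by semicontinuity of [Psi], one by continuity of [Phi]. *)
  have [a aPsi aPhi] : exists2 a : R, (a%:E < Psi v)%E & c - a < Phi v.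
    case: (Psi v) cv (noo v) => [r| |] // cv _.
      exists ((r + c - Phi v) / 2); move: cv; rewrite -EFinD !lte_fin; lra.
    by exists (c - Phi v + 1); rewrite ?ltry //; lra.
  have [V nV hV] := lsc v a aPsi.
  have nP : \forall w \near v, c - a < Phi w by exact: cvgr_gt (ctsPhi v) _ aPhi.
  have [w [Cw [/hV aw]]] := vcl _ (filterI nV nP).
  move: Cw aw; rewrite /C /=; case: (Psi w) (noo w) => [r| |] // _.
  by rewrite -EFinD lee_fin lte_fin; lra.
move=> a b; rewrite /C /= => Ca Cb.
have -> : 2^-1 *: (a + b) = 2^-1 *: a + (1 - 2^-1) *: b.
  by rewrite scalerDr; congr (_ + _ *: _); field.
have h01 : 0 < (2^-1 : R) < 1 by lra.
have h01' : 0 <= (2^-1 : R) <= 1 by lra.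
have := cvxPsi a b _ h01; have := cvxPhi a b _ h01'.
rewrite /=; set v := _ + _.
move: Ca Cb; case: (Psi a) (noo a) => [ra| |] // _; case: (Psi b) (noo b) => [rb| |] // _.
case: (Psi v) => [r| |] //=; rewrite -?EFinM -?EFinD ?lee_fin ?leye_eq ?leNye //; lra.
Qed.


Lemma cvg0_sqr {R : realType} (u : nat -> R) :
  (fun n => u n ^+ 2) @ \oo --> (0 : R) -> u @ \oo --> (0 : R).
Proof.
move=> u2; apply/cvgrPdist_lt => e e0.
have : \forall n \near \oo, `|0 - u n ^+ 2| < e ^+ 2.
  by move/cvgrPdist_lt: u2; apply; rewrite exprn_gt0.
apply: filterS => n; rewrite !sub0r !normrN normrX.
by rewrite ltr_sqr ?nnegrE // ltW.
Qed.

Lemma partial_sum_shift_le {R : realType} (a : nat -> R) :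
    (forall n, 0 <= a n) -> (\sum_(1 <= k <oo) (a k)%:E < +oo)%E ->
  exists B, forall n, \sum_(0 <= j < n) a j.+2 <= B.
Proof.
move=> a0 alt.
have age : (0 <= \sum_(1 <= k <oo) (a k)%:E)%E.
  by apply: nneseries_ge0 => n _ _; rewrite lee_fin.
exists (fine (\sum_(1 <= k <oo) (a k)%:E)%E) => n.
rewrite -lee_fin fineK ?ge0_fin_numE //.
have := @nneseries_lim_ge R (fun k => (a k)%:E) xpredT 1%N n.+2.
rewrite sumEFin => /(_ (fun k _ _ => a0 k)); apply: le_trans.
rewrite lee_fin [leRHS]big_ltn // -[n.+2]addn2 (big_addn 0 (n + 2) 2) addnK.
by under [in leRHS]eq_bigr do rewrite addn2; rewrite lerDr.
Qed.

(** * Rates and weak convergence of the inexact scheme *)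

Theorem theorem3 (R : realType) (H : completeNormedModType R)
  (ip : H -> H -> R) (Hip : is_inner_product ip)
  (Psi : H -> \bar R) (Phi : H -> R) (gradPhi : H -> H) (L : R)
  (Psi_proper : proper_fun Psi) (Psi_lsc : lower_semicontinuous Psi)
  (Psi_convex : convex_ext Psi) (Phi_convex : convex_real Phi)
  (Phi_diff : forall x, differentiable Phi x /\
                forall h, 'd Phi x h = ip (gradPhi x) h)
  (L_pos : 0 < L)
  (grad_lip : forall x y, `|gradPhi x - gradPhi y| <= L * `|x - y|)
  (S_nonempty : exists z : H, forall u : H,
      (Psi z + (Phi z)%:E <= Psi u + (Phi u)%:E)%E)
  (alpha s : R) (alpha_gt3 : 3 < alpha) (s_pos : 0 < s) (s_lt : s < L^-1)
  (g : nat -> H) (x : nat -> H)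
  (Hx : forall k : nat, (1 <= k)%N ->
     let y := x k + ((k%:R - 1) / (k%:R + alpha - 1)) *: (x k - x k.-1) in
     is_prox s Psi (y - s *: (gradPhi y - g k)) (x k.+1))
  (Hg : (\sum_(1 <= k <oo) ((k%:R * `|g k|)%:E) < +oo)%E) :
  (forall z : H, (forall u : H, (Psi z + (Phi z)%:E <= Psi u + (Phi u)%:E)%E) ->
     (fun k : nat => ((k%:R ^+ 2)%:E *
        ((Psi (x k) + (Phi (x k))%:E) - (Psi z + (Phi z)%:E)))%E)
       @ \oo --> 0%E)
  /\ (fun k : nat => k%:R * `|x k.+1 - x k|) @ \oo --> (0 : R)
  /\ (exists2 xinf : H,
        (forall u : H, (Psi xinf + (Phi xinf)%:E <= Psi u + (Phi u)%:E)%E)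
        & weak_cvg ip x xinf).
Proof.
have [Psi_noo _] := Psi_proper.
have hsub a b : Phi a + ip (gradPhi a) (b - a) <= Phi b.
  by have [? ?] := Phi_diff a; exact: (gradient_inequality Phi gradPhi a b).
have Phi_cts : continuous Phi.
  by move=> v; apply: differentiable_continuous; have [] := Phi_diff v.
have [z0 z0P] := S_nonempty.
have finZ z : (forall u, (Psi z + (Phi z)%:E <= Psi u + (Phi u)%:E)%E) ->
    Psi z \is a fin_num.
  have [_ [u u_fin]] := Psi_proper; move=> /(_ u); rewrite fin_numE Psi_noo.
  by case: (Psi u) u_fin (Psi_noo u) => // r _ _; case: (Psi z).
(* [fine] sends infinite values to 0, so [F] is the objective only where [Psi] is finite. *)
pose F v := fine (Psi v) + Phi v.
have FE v : Psi v \is a fin_num -> (Psi v + (Phi v)%:E)%E = (F v)%:E.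
  by move=> /fineK <-.
pose m := F z0.
have FZ z : (forall u, (Psi z + (Phi z)%:E <= Psi u + (Phi u)%:E)%E) -> F z = m.
  move=> zP; apply/eqP; rewrite eq_le -!lee_fin -!FE ?finZ //.
  by rewrite zP z0P.
have xfin n : Psi (x n.+2) \is a fin_num.
  exact: prox_fin_num Psi_proper (Hx n.+1 isT).
pose X n := x n.+1.
pose th n := F (X n.+1) - m.
pose lam := alpha - 1.
have lam2 : 2 < lam by rewrite /lam; lra.
have lam0 : 0 < lam by lra.
have sL : s * L <= 1 by rewrite -ler_pdivlMr // mul1r ltW.
have th0 n : 0 <= th n.
  by rewrite subr_ge0 -lee_fin -(FE _ (finZ _ z0P)) -(FE _ (xfin n)).
pose y n := X n.+1 + (n.+1%:R / (n.+2%:R + lam)) *: (X n.+1 - X n).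
have fb n u : Psi u \is a fin_num -> F (X n.+2) <= F u +
    s^-1 * ip (y n - X n.+2) (X n.+2 - u) +
    ip (g n.+2) (X n.+2 - u) + L / 2 * `|X n.+2 - y n| ^+ 2.
  move=> ufin; have := Hx n.+2 isT.
  have -> : n.+2%:R - 1 = n.+1%:R :> R by rewrite -natr1 addrK.
  rewrite -addrA /= => prox.
  exact: (forward_backward_inequality Hip _ _ _ _ _ _ _ _ _ s_pos Psi_convex
            hsub grad_lip prox).
have hstep n : th n.+1 <= th n + s^-1 * ip (y n - X n.+2) (X n.+2 - X n.+1) +
    ip (g n.+2) (X n.+2 - X n.+1) + L / 2 * `|X n.+2 - y n| ^+ 2.
  by have := fb n (X n.+1) (xfin n); rewrite /th; lra.
have hmin z : (forall u, (Psi z + (Phi z)%:E <= Psi u + (Phi u)%:E)%E) ->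
    forall n, th n.+1 <= s^-1 * ip (y n - X n.+2) (X n.+2 - z) +
    ip (g n.+2) (X n.+2 - z) + L / 2 * `|X n.+2 - y n| ^+ 2.
  by move=> zP n; have := fb n z (finZ z zP); rewrite /th (FZ z zP); lra.
have [B hB] : exists B, forall n, \sum_(0 <= j < n) j.+2%:R * `|g j.+2| <= B.
  by apply: (partial_sum_shift_le _ _ Hg) => n; exact: mulr_ge0.
have energy z (zP : forall u, (Psi z + (Phi z)%:E <= Psi u + (Phi u)%:E)%E) :=
  inertial_energy Hip X (fun n => g n.+2) th lam s L B z lam2 s_pos sL th0
    hstep (hmin z zP) hB.
have [[W hW] [K hK] _] := energy z0 z0P.
have [M hM] := inertial_bounded X lam W z0 lam0 hW.
(* The weighted velocity is w_n - lam (X_{n+1} - z0), a difference of bounded terms. *)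
have hV n : n.+1%:R * `|X n.+1 - X n| <= W + lam * M.
  rewrite -[X in X * _]normr_nat -normrZ.
  have -> : n.+1%:R *: (X n.+1 - X n) = (n.+1%:R + lam) *: (X n.+1 - z0) -
      n.+1%:R *: (X n - z0) - lam *: (X n.+1 - z0).
    by rewrite (inertial_split Hip) addrAC subrr add0r.
  apply: le_trans (ler_normB _ _) _; rewrite lerD // normrZ gtr0_norm //.
  by rewrite ler_wpM2l // ltW.
have decay := inertial_decay Hip X (fun n => g n.+2) th lam s L B K (W + lam * M)
  lam2 s_pos sL th0 hstep hB hK hV.
have s20 : 0 < (2 * s)^-1 by rewrite invr_gt0 mulr_gt0.
have D0 n : 0 <= (2 * s)^-1 * `|X n.+1 - X n| ^+ 2.
  by rewrite mulr_ge0 ?exprn_ge0 // ltW.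
have cst0 : (fun _ : nat => 0 : R) @ \oo --> (0 : R) by exact: cvg_cst.
have th_cvg : (fun n => (n.+1%:R + lam) ^+ 2 * th n) @ \oo --> (0 : R).
  apply: squeeze_cvgr cst0 decay; near=> n.
  have sq0 : 0 <= (n.+1%:R + lam) ^+ 2 by exact: exprn_even_ge0.
  by rewrite mulr_ge0 //= ler_wpM2l // lerDl.
have v_cvg : (fun n => n.+1%:R * `|X n.+1 - X n|) @ \oo --> (0 : R).
  apply: cvg0_sqr.
  (* The factor 2s clears the coefficient of the squared velocity in the decaying energy. *)
  have decay' : (fun n => 2 * s * ((n.+1%:R + lam) ^+ 2 *
      (th n + (2 * s)^-1 * `|X n.+1 - X n| ^+ 2))) @ \oo --> (0 : R).
    by rewrite -[in X in _ --> X](mulr0 (2 * s)); apply: cvgMr.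
  apply: squeeze_cvgr cst0 decay'; near=> n.
  rewrite exprn_ge0 ?mulr_ge0 //= exprMn.
  apply: (@le_trans _ _ ((n.+1%:R + lam) ^+ 2 * `|X n.+1 - X n| ^+ 2)).
    rewrite ler_wpM2r ?exprn_ge0 // ler_sqr ?nnegrE //; last by rewrite addr_ge0 // ltW.
    by rewrite lerDl ltW.
  rewrite [leRHS]mulrCA ler_wpM2l ?exprn_even_ge0 //.
  by rewrite mulrDr mulVKf ?gt_eqF ?mulr_gt0 // lerDr !mulr_ge0 // ltW.
split; last split.
(* From index 2 on the iterates are proximal points, so the objective is finite and the limit can be
   taken in [R]. *)
- move=> z zP; rewrite -(cvg_shiftn 2) /=.
  have -> : (fun n : nat => (((n + 2)%N%:R ^+ 2)%:E *
      ((Psi (x (n + 2)%N) + (Phi (x (n + 2)%N))%:E) - (Psi z + (Phi z)%:E)))%E) =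
      (fun n => (n.+2%:R ^+ 2 * th n)%:E).
    apply/funext => n; rewrite addn2 (FE _ (xfin n)) (FE _ (finZ z zP)) (FZ z zP).
    by rewrite -EFinB -EFinM.
  apply: cvg_EFin; first by near=> n.
  apply: squeeze_cvgr cst0 th_cvg; near=> n.
  rewrite /= mulr_ge0 ?exprn_even_ge0 //= ler_wpM2r // ler_sqr ?nnegrE //.
    by rewrite -natr1 lerD2l; lra.
  by rewrite addr_ge0 // ltW.
- by rewrite -cvg_shiftS.
have [||| xinf xinfP xcvg] := opial Hip (fun n => X n.+1) (M + `|z0|)
    [set z | forall u, (Psi z + (Phi z)%:E <= Psi u + (Phi u)%:E)%E].
- move=> n; rewrite -[X n.+1](subrK z0); apply: le_trans (ler_normD _ _) _.
  by rewrite lerD2r.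
- move=> p pP; have [[W' hW'] _ ce] := energy p pP.
  apply: (inertial_dist_cvg Hip X lam W' p lam0 hW') => //.
  have cth : cvgn (fun n => (n.+1%:R + lam) ^+ 2 * th n) := cvgP _ th_cvg.
  (* Up to the factor 2s, |w|^2 is the energy minus its value part, and both converge. *)
  pose w2 n := `|(n.+1%:R + lam) *: (X n.+1 - p) - n.+1%:R *: (X n - p)| ^+ 2.
  change (cvgn w2); have -> : w2 = (fun n => 2 * s * ((n.+1%:R + lam) ^+ 2 * th n +
      (2 * s)^-1 * w2 n - (n.+1%:R + lam) ^+ 2 * th n)).
    apply/funext => n; rewrite addrAC subrr add0r mulVKf // gt_eqF //.
    exact: mulr_gt0.
  by apply: is_cvgM; [exact: is_cvg_cst | exact: is_cvgB].
(* The values tend to [m], so every sublevel set at m + e contains a tail and hence [p]. *)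
- move=> p pP u; apply: (@le_trans _ _ m%:E); last by rewrite -(FE _ (finZ _ z0P)).
  apply/lee_addgt0Pr => e e0; rewrite -EFinD.
  have [cl mid] := sublevel_closed_midconvex Psi Phi (m + e) Psi_noo Psi_lsc
    Psi_convex Phi_cts Phi_convex.
  apply: (pP _ cl mid); have : \forall n \near \oo, (n.+1%:R + lam) ^+ 2 * th n <= e.
    exact: (cvgr_le _ th_cvg).
  apply: filterS => n; rewrite /= (FE _ (xfin n)) lee_fin => h.
  suff : th n <= e by rewrite /th; lra.
  apply: le_trans h; rewrite ler_peMl // exprn_ege1 //.
  by have : 0 <= n.+1%:R :> R by []; lra.
exists xinf => // v; rewrite -(cvg_shiftn 2) /=.
by under eq_fun do rewrite addn2; exact: xcvg.
Unshelve. all: by end_near. Qed.
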